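(* Let $\mathcal{E}$ be the Dirichlet form of a generator $L$ on a finite probability space $(\Omega,\mu)$. Let $I$ be a convex non-empty subset of $\mathbb{R}$ and let $\varphi_1,\varphi_2,\psi_1,\psi_2:I\to\mathbb{R}$ be differentiable functions such that $$\varphi_1'(a)\varphi_2'(b)+\varphi_1'(b)\varphi_2'(a)\le\psi_1'(a)\psi_2'(b)+\psi_1'(b)\psi_2'(a)$$ for all $a,b\in I$. Then for every $f:\Omega\to I$ $$\mathcal{E}(\varphi_1(f),\varphi_2(f))\le\mathcal{E}(\psi_1(f),\psi_2(f)),$$ where $\varphi_1(f)$ denotes $\varphi_1\circ f$, etc.
   Context: Setting: $(\Omega,\mu)$ is a finite probability space with $\mu\{\omega\}>0$ for all $\omega\in\Omega$; $\mathbb{E}f=\int_\Omega f\,d\mu$; $\mathcal{H}$ is the space of real-valued functions on $\Omega$. A generator is a linear operator $L:\mathcal{H}\to\mathcal{H}$ such that: $L1=0$; $\mathbb{E}[fLg]=\mathbb{E}[gLf]$ for all $f,g\in\mathcal{H}$; $\mathbb{E}[fLf]\ge 0$ for all $f\in\mathcal{H}$; and whenever $f\in\mathcal{H}$ and $\omega\in\Omega$ satisfy $f\le f(\omega)$ on $\Omega$, then $(Lf)(\omega)\ge 0$. The Dirichlet form is $\mathcal{E}(f,g)=\mathbb{E}[fLg]$. At endpoints of $I$ belonging to $I$, derivatives are one-sided. *)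

(* Defs.v *)
From HB Require Import structures.
From mathcomp Require Import all_boot all_order all_algebra.
From mathcomp Require Import all_classical all_reals all_analysis.
Import Order.TTheory GRing.Theory Num.Theory.
Import numFieldNormedType.Exports.

Set Implicit Arguments.
Unset Strict Implicit.
Unset Printing Implicit Defensive.

Local Open Scope classical_set_scope.
Local Open Scope ring_scope.

(* The measure is given by its point masses mu w = mu {w}, all positive. *)
Record finite_probability (R : realType) (Omega : finType) (mu : Omega -> R)
    : Prop := {
  mass_gt0 : forall w, 0 < mu w ;
  mass_sum1 : \sum_w mu w = 1
}.

Definition expect (R : realType) (Omega : finType) (mu f : Omega -> R) : R :=
  \sum_w mu w * f w.

(* The space of real-valued functions on Omega is Omega -> R^o, with its
   pointwise R-module structure; linearity of L is carried by its type. *)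
Record is_generator (R : realType) (Omega : finType) (mu : Omega -> R)
    (L : {linear (Omega -> R^o) -> (Omega -> R^o)}) : Prop := {
  generator_const : L (cst 1) = cst 0 ;
  generator_sym : forall f g : Omega -> R^o,
    expect mu (fun w => f w * L g w) = expect mu (fun w => g w * L f w) ;
  generator_ge0 : forall f : Omega -> R^o,
    0 <= expect mu (fun w => f w * L f w) ;
  generator_max : forall (f : Omega -> R^o) (w : Omega),
    (forall v, f v <= f w) -> 0 <= L f w
}.

Definition dirichlet_form (R : realType) (Omega : finType) (mu : Omega -> R)
    (L : {linear (Omega -> R^o) -> (Omega -> R^o)}) (f g : Omega -> R^o) : R :=
  expect mu (fun w => f w * L g w).

(* Differentiation relative to I: the difference quotient only sees points of
   I other than a, hence the usual derivative at interior points of I and the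
   one-sided derivative at endpoints of I belonging to I.  A function on I is
   represented by a function on R, whose values outside I are irrelevant here.
   If I = {a} the filter below is improper: every function is then derivable at
   a and the value of the derivative is a default that does not depend on the
   function. *)
Definition derivable_within (R : realType) (I : set R) (phi : R -> R) (a : R)
    : Prop :=
  cvg ((phi x - phi a) / (x - a) @[x --> within I a^']).

Definition derive_within (R : realType) (I : set R) (phi : R -> R) (a : R) : R :=
  lim ((phi x - phi a) / (x - a) @[x --> within I a^']).

(* Main.v *)
Require Import Defs.
From HB Require Import structures.
From mathcomp Require Import all_boot all_order all_algebra.
From mathcomp Require Import all_classical all_reals all_analysis.
From mathcomp Require Import ring lra.
Import Order.TTheory GRing.Theory Num.Theory.
Import numFieldNormedType.Exports.
Set Implicit Arguments.
Unset Strict Implicit.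
Unset Printing Implicit Defensive.

Local Open Scope classical_set_scope.
Local Open Scope ring_scope.

(** Let delta_v be the indicator of the point v.  The reals
    c(w,v) = - mu(w) (L delta_v)(w) are symmetric because L is symmetric, sum
    to zero in v because L kills constants, and are nonnegative for w <> v by
    the maximum principle at w, where - delta_v attains its maximum 0.
    Expanding L on indicators therefore gives
      2 E(f,g) = sum over w, v of c(w,v) (f w - f v) (g w - g v)
    ([dirichlet_formE]), where the diagonal terms vanish and all other weights
    are nonnegative.  Comparing two Dirichlet forms is thus reduced to comparing
    products of increments between pairs of points ([dirichlet_form_le]), and
    the theorem to the inequality
      (phi1 x - phi1 y) (phi2 x - phi2 y) <= (psi1 x - psi1 y) (psi2 x - psi2 y)
    for x, y in I ([increment_prod_le]).

    The derivatives need not be integrable, so this inequality is not obtained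
    by integrating the hypothesis over the square [x, y] x [x, y].  Twice its
    left side minus twice its right side is the second increment over that
    square of
      K(s,t) = phi1 s phi2 t + phi1 t phi2 s - psi1 s psi2 t - psi1 t psi2 s,
    and the hypothesis says that the mixed derivative of K is nonpositive.  The
    mean value theorem, used in the variable s and then in t, writes the
    increment as that mixed derivative at some point times (y - x) ^ 2. *)

Lemma convex_set_interval (R : realType) (I : set R) :
  convex_set (I : set R^o) -> is_interval I.
Proof.
move=> cI x y Ix Iy z /andP[xz zy].
have [xy|yx] := ltP x y; last first.
  by have -> : z = x by apply/eqP; rewrite eq_le xz (le_trans zy yx).
have yx0 : 0 < y - x by rewrite subr_gt0.
have t0 : 0 <= (y - z) / (y - x) by rewrite divr_ge0 ?subr_ge0// ltW.
have t1 : (y - z) / (y - x) <= 1 by rewrite ler_pdivrMr// mul1r lerB.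
have /set_mem := cI x y (Itv01 t0 t1) (mem_set Ix) (mem_set Iy).
rewrite [X in I X -> _]convRE /=.
rewrite /unstable.onem; congr (I _); field; exact: lt0r_neq0.
Qed.

Lemma cvg_derive_within (R : realType) (I : set R) (phi : R -> R) (a : R) :
  derivable_within I phi a ->
  (phi x - phi a) / (x - a) @[x --> within I a^'] --> derive_within I phi a.
Proof. by []. Qed.

(** At an interior point of I the restriction to I disappears from the filter,
    leaving the usual two-sided limit. *)
Lemma derivable_within_is_derive (R : realType) (I : set R) (phi : R -> R)
    (a : R) :
  nbhs a I -> derivable_within I phi a ->
  is_derive a 1 phi (derive_within I phi a).
Proof.
move=> Ia /cvg_derive_within dphi.
have sh : h + a @[h --> 0^'] --> within I a^'.
  move=> P; rewrite /within/= /dnbhs /within/= => aP.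
  have : \forall x \near a, x != a -> P x.
    near=> x => xa.
    have Ix : I x by near: x.
    by move: xa Ix; near: x.
  rewrite (near_shift 0) subr0; apply: filterS => h /= hP h0.
  by apply: hP; rewrite -subr_eq0 addrK.
have cv : h^-1 *: ((phi \o shift a) (h *: 1) - phi a) @[h --> 0^'] -->
    derive_within I phi a.
  apply: cvg_trans (cvg_comp _ _ sh dphi); apply: near_eq_cvg.
  by near=> h; rewrite /= addrK mulrC [_%:A]mulr1.
apply: DeriveDef; first by apply/cvg_ex; eexists; exact: cv.
exact: cvg_lim cv.
Unshelve. all: by end_near. Qed.

(** The increment of phi is its difference quotient, which converges, times
    x - a, which tends to 0. *)
Lemma derivable_within_cvg (R : realType) (I : set R) (phi : R -> R) (a : R) :
  derivable_within I phi a -> phi x @[x --> within I (nbhs a)] --> phi a.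
Proof.
move=> /cvg_derive_within dphi.
have FI : Filter (within I a^') by exact: within_filter.
have xa0 : x - a @[x --> within I a^'] --> (0 : R).
  rewrite -(subrr a); apply: cvgB; last exact: cvg_cst.
  by move=> P aP; apply: filterS aP => x Px _.
have cv := cvgD (cvgM dphi xa0) (cvg_cst (phi a)).
rewrite mulr0 add0r in cv.
move=> P Pa.
have hP : \forall x \near a, x != a -> I x ->
  P ((phi x - phi a) / (x - a) * (x - a) + phi a) := cv FI FI FI P Pa.
suff : \forall x \near a, I x -> P (phi x) by [].
near=> x => Ix.
have Px : x != a -> I x -> P ((phi x - phi a) / (x - a) * (x - a) + phi a).
  by near: x.
(* The difference quotient says nothing at x = a, where phi x = phi a. *)
have [->|xa] := eqVneq x a; first exact: nbhs_singleton.
by move: (Px xa Ix); rewrite divfK ?subr_eq0// subrK.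
Unshelve. all: by end_near. Qed.

(** The two conclusions are what the mean value theorem asks for on [x, y]. *)
Lemma derivable_within_itv (R : realType) (I : set R) (x y : R) :
    is_interval I -> I x -> I y -> x < y ->
  forall phi : R -> R, (forall a, I a -> derivable_within I phi a) ->
    {within `[x, y], continuous phi} /\
    (forall a, a \in `]x, y[ -> is_derive a 1 phi (derive_within I phi a)).
Proof.
move=> iI Ix Iy xy phi dphi.
have sI a : x <= a <= y -> I a by exact: iI.
split.
  apply/subspace_continuousP => a /=; rewrite in_itv/= => axy.
  apply: cvg_trans (derivable_within_cvg (dphi a (sI a axy))).
  apply: cvg_app => P aP.
  suff : \forall z \near a, `[x, y]%classic z -> P z by [].
  near=> z; rewrite /= in_itv/= => /sI.
  by near: z.
move=> a axy; apply: derivable_within_is_derive; last first.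
  by apply/dphi/sI; move: axy; rewrite in_itv/= => /andP[/ltW-> /ltW->].
apply: filterS (near_in_itvoo axy) => z /=.
by rewrite in_itv/= => /andP[/ltW xz /ltW zy]; apply: sI; rewrite xz.
Unshelve. all: by end_near. Qed.

(** A mean value theorem for the symmetric bilinear expression in the
    hypothesis: one variable is treated at a time, so that each application
    concerns a linear combination of the four functions. *)
Lemma increment_prod_le (R : realType) (I : set R)
    (phi1 phi2 psi1 psi2 : R -> R) :
    is_interval I ->
    (forall a, I a -> derivable_within I phi1 a) ->
    (forall a, I a -> derivable_within I phi2 a) ->
    (forall a, I a -> derivable_within I psi1 a) ->
    (forall a, I a -> derivable_within I psi2 a) ->
    (forall a b, I a -> I b ->
      derive_within I phi1 a * derive_within I phi2 b
        + derive_within I phi1 b * derive_within I phi2 a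
      <= derive_within I psi1 a * derive_within I psi2 b
        + derive_within I psi1 b * derive_within I psi2 a) ->
  forall x y, I x -> I y ->
    (phi1 x - phi1 y) * (phi2 x - phi2 y)
      <= (psi1 x - psi1 y) * (psi2 x - psi2 y).
Proof.
move=> iI d1 d2 e1 e2 dle x y Ix Iy.
wlog xy : x y Ix Iy / x < y => [H|].
  have [xy|yx|->] := ltgtP x y; first exact: H.
    have := H _ _ Iy Ix yx; lra.
  by rewrite !subrr !mul0r.
have [c1 D1] := derivable_within_itv iI Ix Iy xy d1.
have [c2 D2] := derivable_within_itv iI Ix Iy xy d2.
have [k1 E1] := derivable_within_itv iI Ix Iy xy e1.
have [k2 E2] := derivable_within_itv iI Ix Iy xy e2.
(* With the increments of the functions (resp. their derivatives at s) as
   coefficients, G is the partial increment (resp. partial derivative) of the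
   bilinear expression in one variable, seen as a function of the other. *)
pose G (p1 p2 q1 q2 : R) t :=
  (p1 * phi2 t + p2 * phi1 t) - (q1 * psi2 t + q2 * psi1 t).
pose dG (p1 p2 q1 q2 : R) t :=
  (p1 * derive_within I phi2 t + p2 * derive_within I phi1 t)
  - (q1 * derive_within I psi2 t + q2 * derive_within I psi1 t).
have mvt p1 p2 q1 q2 : exists2 c, c \in `]x, y[ &
    G p1 p2 q1 q2 y - G p1 p2 q1 q2 x = dG p1 p2 q1 q2 c * (y - x).
  apply: MVT => //.
    move=> c cxy.
    have := D1 c cxy; have := D2 c cxy; have := E1 c cxy; have := E2 c cxy.
    move=> *; apply: is_deriveB; apply: is_deriveD; exact: is_deriveZ.
  move=> z; apply: cvgB; apply: cvgD; apply: cvgM; try exact: cvg_cst.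
  - exact: c2. - exact: c1. - exact: k2. - exact: k1.
have inI c : c \in `]x, y[ -> I c.
  by rewrite in_itv/= => /andP[/ltW xc /ltW cy]; apply: iI Ix Iy _ _;
    rewrite xc.
have [s sxy Gs] := mvt (phi1 y - phi1 x) (phi2 y - phi2 x)
                       (psi1 y - psi1 x) (psi2 y - psi2 x).
have [t txy Gt] := mvt (derive_within I phi1 s) (derive_within I phi2 s)
                       (derive_within I psi1 s) (derive_within I psi2 s).
have le0 := dle s t (inI _ sxy) (inI _ txy).
have yx0 : 0 < y - x by rewrite subr_gt0.
(* By symmetry, the derivative at s of the first G is the increment of the
   second G, to which the mean value theorem applies again. *)
have dGs : dG (phi1 y - phi1 x) (phi2 y - phi2 x)
              (psi1 y - psi1 x) (psi2 y - psi2 x) s <= 0.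
  have -> : dG (phi1 y - phi1 x) (phi2 y - phi2 x)
               (psi1 y - psi1 x) (psi2 y - psi2 x) s
      = dG (derive_within I phi1 s) (derive_within I phi2 s)
           (derive_within I psi1 s) (derive_within I psi2 s) t * (y - x).
    by rewrite -Gt /dG /G; ring.
  by rewrite pmulr_lle0// /dG; lra.
have : dG (phi1 y - phi1 x) (phi2 y - phi2 x)
          (psi1 y - psi1 x) (psi2 y - psi2 x) s * (y - x) <= 0.
  by rewrite pmulr_lle0.
rewrite -Gs /G; lra.
Qed.

Definition point_indicator (R : realType) (Omega : finType) (v w : Omega)
    : R^o :=
  (w == v)%:R.

(** For w <> v, this is mu w times the rate of jump from w to v of the reversible
    Markov chain with generator - L. *)
Definition conductance (R : realType) (Omega : finType) (mu : Omega -> R)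
    (L : {linear (Omega -> R^o) -> (Omega -> R^o)}) (w v : Omega) : R :=
  - (mu w * L (point_indicator R v) w).

Lemma linear_point_indicatorE (R : realType) (Omega : finType)
    (L : {linear (Omega -> R^o) -> (Omega -> R^o)}) (g : Omega -> R^o) w :
  L g w = \sum_v g v * L (point_indicator R v) w.
Proof.
have {1}-> : g = \sum_v g v *: point_indicator R v.
  apply/funext => u; rewrite fct_sumE (bigD1 u)//= big1 => [|v vu].
    rewrite addr0 -[LHS]mulr1; congr (_ * _).
    by rewrite /point_indicator eqxx.
  by rewrite -(mulr0 (g v)); congr (_ * _);
    rewrite /point_indicator eq_sym (negbTE vu).
by rewrite linear_sum fct_sumE; apply: eq_bigr => v _; rewrite linearZ.
Qed.

Lemma expect_point_indicator (R : realType) (Omega : finType) (mu f : Omega -> R)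
    v :
  expect mu (fun w => point_indicator R v w * f w) = mu v * f v.
Proof.
rewrite /expect (bigD1 v)//= big1 => [|w wv].
  by rewrite addr0 /point_indicator eqxx mul1r.
by rewrite /point_indicator (negbTE wv) mul0r mulr0.
Qed.

Section generator.
Context (R : realType) (Omega : finType) (mu : Omega -> R)
  (L : {linear (Omega -> R^o) -> (Omega -> R^o)}) (genL : is_generator mu L).
Local Notation c := (conductance mu L).

Lemma conductance_sym w v : c w v = c v w.
Proof.
have := generator_sym genL (point_indicator R w) (point_indicator R v).
by rewrite !expect_point_indicator /conductance => ->.
Qed.

Lemma conductance_sum0 w : \sum_v c w v = 0.
Proof.
have := congr1 (fun h => mu w * h w) (generator_const genL).
rewrite linear_point_indicatorE /= mulr0 mulr_sumr => /(congr1 -%R).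
rewrite oppr0 -sumrN => h; rewrite -[RHS]h.
by apply: eq_bigr => v _; rewrite /cst mul1r.
Qed.

(** The maximum principle is applied to minus the indicator of v, which is
    nonpositive and vanishes at w. *)
Lemma conductance_ge0 w v : finite_probability mu -> w != v -> 0 <= c w v.
Proof.
move=> pmu wv; rewrite /conductance -mulrN.
apply: mulr_ge0; first exact/ltW/(mass_gt0 pmu).
have := generator_max genL (f := - point_indicator R v) (w := w).
rewrite linearN => H; apply: H => u.
by rewrite !fctE /point_indicator (negbTE wv) oppr0 oppr_le0 ler0n.
Qed.

(** Expand the product of increments: the terms f w * g w and f v * g v
    contribute nothing because the conductances have zero row sums, and by
    symmetry the two cross terms are equal. *)
Lemma dirichlet_formE f g :
  2 * dirichlet_form mu L f g =
  \sum_w \sum_v c w v * ((f w - f v) * (g w - g v)).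
Proof.
have offdiag : dirichlet_form mu L f g = - \sum_w \sum_v c w v * (f w * g v).
  rewrite /dirichlet_form /expect -sumrN; apply: eq_bigr => w _.
  rewrite linear_point_indicatorE !mulr_sumr -sumrN; apply: eq_bigr => v _.
  by rewrite /conductance; ring.
have diag (h : Omega -> R) : \sum_w \sum_v c w v * h w = 0.
  by apply: big1 => w _; rewrite -mulr_suml conductance_sum0 mul0r.
have swap (h : Omega -> Omega -> R) :
    \sum_w \sum_v c w v * h v w = \sum_w \sum_v c w v * h w v.
  rewrite exchange_big; apply: eq_bigr => w _; apply: eq_bigr => v _.
  by rewrite conductance_sym.
transitivity (\sum_w \sum_v c w v * (f w * g w)
  + \sum_w \sum_v c w v * (f v * g v)
  - \sum_w \sum_v c w v * (f w * g v) - \sum_w \sum_v c w v * (f v * g w)).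
  rewrite (swap (fun w _ => f w * g w)) (swap (fun w v => f w * g v)).
  by rewrite diag offdiag; ring.
rewrite -!sumrN -!big_split/=; apply: eq_bigr => w _.
by rewrite -!sumrN -!big_split/=; apply: eq_bigr => v _; ring.
Qed.

Lemma dirichlet_form_le (f1 f2 g1 g2 : Omega -> R^o) :
    finite_probability mu ->
    (forall w v, (f1 w - f1 v) * (f2 w - f2 v)
      <= (g1 w - g1 v) * (g2 w - g2 v)) ->
  dirichlet_form mu L f1 f2 <= dirichlet_form mu L g1 g2.
Proof.
move=> pmu le12; rewrite -(ler_pM2l (@ltr0Sn R 1)) !dirichlet_formE.
apply: ler_sum => w _; apply: ler_sum => v _.
have [->|wv] := eqVneq w v; first by rewrite !subrr !mul0r.
exact/ler_wpM2l/le12/conductance_ge0.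
Qed.

End generator.

Theorem lemma2p4 (R : realType) (Omega : finType) (mu : Omega -> R)
    (L : {linear (Omega -> R^o) -> (Omega -> R^o)})
    (I : set R) (phi1 phi2 psi1 psi2 : R -> R) :
  finite_probability mu ->
  is_generator mu L ->
  convex_set (I : set R^o) ->
  I !=set0 ->
  (forall a, I a -> derivable_within I phi1 a) ->
  (forall a, I a -> derivable_within I phi2 a) ->
  (forall a, I a -> derivable_within I psi1 a) ->
  (forall a, I a -> derivable_within I psi2 a) ->
  (forall a b, I a -> I b ->
    derive_within I phi1 a * derive_within I phi2 b
      + derive_within I phi1 b * derive_within I phi2 a
    <= derive_within I psi1 a * derive_within I psi2 b
      + derive_within I psi1 b * derive_within I psi2 a) ->
  forall f : Omega -> R, (forall w, I (f w)) ->
    dirichlet_form mu L (phi1 \o f) (phi2 \o f)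
      <= dirichlet_form mu L (psi1 \o f) (psi2 \o f).
Proof.
move=> pmu genL cI _ d1 d2 e1 e2 dle f If.
apply: dirichlet_form_le => // w v.
exact: (increment_prod_le (convex_set_interval cI) d1 d2 e1 e2 dle).
Qed.
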